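(* Let $\rho:\pi_1(W)\to\mathbf{PU}(2,1)$ be the representation of the fundamental group of the Whitehead link complement $W$ whose image is generated by the classes of the matrices $$G_1=\begin{bmatrix}1&0&-i\\-1-i&1&-1+i\\-1-i&1-i&i\end{bmatrix},\quad G_2=\begin{bmatrix}1&1-i&-1+i\\-1-i&-1&1-i\\-1+i&1+i&-1-2i\end{bmatrix},$$ $$G_3=\begin{bmatrix}i&1+i&-i\\1-i&-1-2i&2i\\-1-i&-3+i&3+2i\end{bmatrix},\quad G_4=\begin{bmatrix}-i&0&0\\-1+i&-1&0\\-1+i&-1+i&-i\end{bmatrix}.$$ Then the image of $\rho$ is contained in $\mathbf{PU}(2,1,\mathbb{Z}[i])$ and is therefore discrete.
   Context: $\mathbf{PU}(2,1)$ is the projective unitary group of the Hermitian form $\langle z,w\rangle = z_1\overline{w}_3+z_2\overline{w}_2+z_3\overline{w}_1$ on $\mathbb{C}^3$, of signature $(2,1)$. $\mathbf{PU}(2,1,\mathbb{Z}[i])$ is the subgroup of classes of matrices which are unitary for this form and have entries in the Gaussian integers $\mathbb{Z}[i]$. A representation is discrete if its image is a discrete subgroup. *)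

(* Defs.v *)
From HB Require Import structures.
From mathcomp Require Import all_boot all_order all_algebra generic_quotient.
From mathcomp Require Import all_classical all_reals all_analysis.
From mathcomp Require Import homotopy complex ring lra.
Set Implicit Arguments.
Unset Strict Implicit.
Unset Printing Implicit Defensive.
Import Order.TTheory GRing.Theory Num.Theory.
Import numFieldNormedType.Exports.
Local Open Scope classical_set_scope.
Local Open Scope ring_scope.
Local Open Scope quotient_scope.

(* R[i] carries a topology only through the alias R[i]^o. *)
Notation Cplx R := (R[i])^o.

Section Subgroups.
Context (G : groupType).

Definition subgroup (H : set G) : Prop :=
  [/\ H 1%g, forall x y, H x -> H y -> H (x * y)%g & forall x, H x -> H (x^-1)%g].

Definition generated_subgroup (S : set G) : set G :=
  \bigcap_(H in [set H | subgroup H /\ S `<=` H]) H.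

End Subgroups.

Section UnitInterval.
Context (R : realType).

Definition unit_interval : Type := `[(0 : R), 1]%classic.
HB.instance Definition _ := [isSub of unit_interval for
  val : {x | x \in `[(0 : R), 1]%classic} -> R].
HB.instance Definition _ := [Choice of unit_interval by <:].
HB.instance Definition _ := Topological.copy unit_interval `[(0 : R), 1]%classic.

Definition coord : unit_interval -> R := val.
Arguments coord : simpl never.

Lemma coord_inj : injective coord. Proof. exact: val_inj. Qed.

Definition clamp_def (x : R) : R := Num.max 0 (Num.min 1 x).

Lemma clamp_subproof (x : R) : clamp_def x \in `[(0 : R), 1]%classic.
Proof.
rewrite inE /= in_itv /= /clamp_def le_max lexx /=.
by rewrite ge_max ler01 ge_min lexx.
Qed.

(* the nearest-point retraction of R onto [0, 1] *)
Definition clamp (x : R) : unit_interval := Sub (clamp_def x) (clamp_subproof x).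

Lemma coord_clamp x : coord (clamp x) = clamp_def x. Proof. by []. Qed.

Lemma unit_interval_bounds (s : unit_interval) : 0 <= coord s <= 1.
Proof. by have := valP s; rewrite inE /= in_itv. Qed.

Lemma clampK (s : unit_interval) : clamp (coord s) = s.
Proof.
apply: coord_inj; rewrite coord_clamp /clamp_def.
have /andP[s0 s1] := unit_interval_bounds s.
by rewrite min_r // max_r.
Qed.

Lemma clamp_itv x : 0 <= x <= 1 -> coord (clamp x) = x.
Proof. by move=> /andP[x0 x1]; rewrite coord_clamp /clamp_def min_r // max_r. Qed.

Lemma clamp_le0 x : x <= 0 -> clamp x = clamp 0.
Proof.
move=> x0; apply: coord_inj; rewrite !coord_clamp /clamp_def.
by rewrite !min_r ?max_l // (le_trans x0).
Qed.

Lemma clamp_ge1 x : 1 <= x -> clamp x = clamp 1.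
Proof. by move=> x1; apply: coord_inj; rewrite !coord_clamp /clamp_def !min_l. Qed.

Lemma unit_interval_zero_one : clamp 0 != clamp 1.
Proof.
by apply/eqP => /(congr1 coord) /eqP; rewrite !clamp_itv ?lexx ?ler01 // eq_sym oner_eq0.
Qed.

HB.instance Definition _ :=
  isBiPointed.Build unit_interval unit_interval_zero_one.

Lemma coord_continuous : continuous coord.
Proof. exact: initial_continuous. Qed.

Lemma clamp_continuous : continuous clamp.
Proof.
apply/continuous_comp_initial => x.
apply: (@continuous_max R R (cst 0) (fun y => Num.min 1 y)); first exact: cvg_cst.
by apply: (@continuous_min R R (cst 1) id); [exact: cvg_cst|exact: cvg_id].
Qed.

End UnitInterval.

Lemma continuous_if_le (R : realType) (T X : topologicalType) (u : T -> R)
    (c : R) (f g : T -> X) :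
  continuous u -> continuous f -> continuous g ->
  (forall x, u x = c -> f x = g x) ->
  continuous (fun x => if u x <= c then f x else g x).
Proof.
move=> cu cf cg fg x V.
suff: nbhs (if u x <= c then f x else g x) V ->
    \forall y \near x, V (if u y <= c then f y else g y) by [].
case: (ltgtP (u x) c) => uxc nV.
- have nu : \forall y \near x, u y < c.
    by apply: (cu x [set y | y < c]); exact: lt_nbhsl.
  near=> y; rewrite ifT; first by near: y; exact: cf.
  by apply: ltW; near: y.
- have nu : \forall y \near x, c < u y.
    by apply: (cu x [set y | c < y]); exact: lt_nbhsr.
  near=> y; rewrite ifF; first by near: y; exact: cg.
  by apply/negbTE; rewrite -ltNge; near: y.
- near=> y; case: ifP => _; near: y; first exact: cf.
  by apply: cg; rewrite -fg.
Unshelve. all: by end_near. Qed.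

Section FundamentalGroup.
Context (R : realType) (X : topologicalType) (x0 : X).
Local Notation I01 := (unit_interval R).

Definition loop : Type := {path I01 from x0 to x0 in X}.
HB.instance Definition _ := Choice.on loop.

Let loop_zero (a : loop) : a zero = x0. Proof. exact: path_zero. Qed.
Let loop_one (a : loop) : a one = x0. Proof. exact: path_one. Qed.

Definition loop_homotopic (a b : loop) : Prop :=
  exists H : I01 * I01 -> X, [/\ continuous H,
    forall s, H (s, zero) = a s, forall s, H (s, one) = b s &
    forall t, H (zero, t) = x0 /\ H (one, t) = x0].

Definition loop_concat_fun (a b : loop) (s : I01) : X :=
  if coord s <= 2^-1 then a (clamp (2 * coord s)) else b (clamp (2 * coord s - 1)).

Let coord_zero : coord (zero : I01) = 0. Proof. by rewrite clamp_itv // lexx ler01. Qed.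
Let coord_one : coord (one : I01) = 1. Proof. by rewrite clamp_itv // lexx ler01. Qed.

Let continuous_compf (T T' T'' : topologicalType) (f : T -> T') (g : T' -> T'') :
  continuous f -> continuous g -> continuous (fun x => g (f x)).
Proof. by move=> cf cg x; apply: continuous_comp; [exact: cf|exact: cg]. Qed.

Let continuous_clamp (T : topologicalType) (u : T -> R) :
  continuous u -> continuous (fun x => clamp (u x)).
Proof. by move=> cu x; apply: continuous_comp; [exact: cu|exact: clamp_continuous]. Qed.

Let continuous_loop (T : topologicalType) (a : loop) (u : T -> R) :
  continuous u -> continuous (fun x => a (clamp (u x))).
Proof.
move=> cu x; apply: (@continuous_comp _ _ _ (fun x => clamp (u x)) a).
  exact: continuous_clamp.
exact: cts_fun.
Qed.

Let continuous_affine (T : topologicalType) (u : T -> R) (p q : R) :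
  continuous u -> continuous (fun x => p * u x + q).
Proof.
move=> cu x; apply: cvgD; last exact: cvg_cst.
by apply: cvgM; [exact: cvg_cst|exact: cu].
Qed.

Let continuous_mull (T : topologicalType) (u : T -> R) (p : R) :
  continuous u -> continuous (fun x => p * u x).
Proof. by move=> cu x; apply: cvgM; [exact: cvg_cst|exact: cu]. Qed.

Let continuous_sub1 (T : topologicalType) (u : T -> R) :
  continuous u -> continuous (fun x => 1 - u x).
Proof. by move=> cu x; apply: cvgB; [exact: cvg_cst|exact: cu]. Qed.

Let continuous_addM (T : topologicalType) (u v u' v' : T -> R) :
  continuous u -> continuous v -> continuous u' -> continuous v' ->
  continuous (fun x => u x * v x + u' x * v' x).
Proof.
move=> cu cv cu' cv' x; apply: cvgD; apply: cvgM.
- exact: cu.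
- exact: cv.
- exact: cu'.
- exact: cv'.
Qed.

Lemma loop_concat_continuous (a b : loop) : continuous (loop_concat_fun a b).
Proof.
apply: continuous_if_le.
- exact: coord_continuous.
- by apply: continuous_loop; apply: continuous_mull; exact: coord_continuous.
- by apply: continuous_loop; apply: continuous_affine; exact: coord_continuous.
- move=> s ->; rewrite mulfV // subrr.
  by rewrite (loop_one a) (loop_zero b).
Qed.

Lemma loop_concat_zero (a b : loop) : loop_concat_fun a b zero = x0.
Proof.
by rewrite /loop_concat_fun coord_zero invr_ge0 ler0n mulr0 (loop_zero a).
Qed.

Lemma loop_concat_one (a b : loop) : loop_concat_fun a b one = x0.
Proof.
rewrite /loop_concat_fun coord_one ifF.
  by rewrite mulr1 (_ : 2 - 1 = 1) ?(loop_one b) //; lra.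
by apply/negbTE; rewrite -ltNge; lra.
Qed.

Definition loop_concat (a b : loop) : loop :=
  mk_path (@loop_concat_continuous a b) (@loop_concat_zero a b)
    (@loop_concat_one a b).

Definition loop_cst : loop := @cst I01 X x0.

Let loop_rev_fun (a : loop) (s : I01) : X := a (clamp (1 - coord s)).

Let loop_rev_continuous a : continuous (loop_rev_fun a).
Proof.
by apply: continuous_loop; apply: continuous_sub1; exact: coord_continuous.
Qed.
Let loop_rev_zero a : loop_rev_fun a zero = x0.
Proof. by rewrite /loop_rev_fun coord_zero subr0 (loop_one a). Qed.
Let loop_rev_one a : loop_rev_fun a one = x0.
Proof. by rewrite /loop_rev_fun coord_one subrr (loop_zero a). Qed.

Definition loop_rev (a : loop) : loop :=
  mk_path (@loop_rev_continuous a) (@loop_rev_zero a) (@loop_rev_one a).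

Let continuous_homotopy (T : topologicalType) (H : I01 * I01 -> X) (f g : T -> I01) :
  continuous H -> continuous f -> continuous g ->
  continuous (fun x => H (f x, g x)).
Proof.
move=> cH cf cg x; apply: (@continuous_comp _ _ _ (fun x => (f x, g x)) H).
  exact: (cvg_pair (cf x) (cg x)).
exact: cH.
Qed.

Let continuous_fst : continuous (fst : I01 * I01 -> I01).
Proof. by move=> x; exact: cvg_fst. Qed.

Let continuous_snd : continuous (snd : I01 * I01 -> I01).
Proof. by move=> x; exact: cvg_snd. Qed.

Let continuous_coord_fst : continuous (fun x : I01 * I01 => coord x.1).
Proof. exact: (continuous_compf continuous_fst (@coord_continuous R)). Qed.

Let continuous_coord_snd : continuous (fun x : I01 * I01 => coord x.2).
Proof. exact: (continuous_compf continuous_snd (@coord_continuous R)). Qed.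

Lemma loop_homotopic_refl a : loop_homotopic a a.
Proof.
exists (fun x => a x.1); split=> //.
- exact: (continuous_compf continuous_fst (@cts_fun _ _ a)).
Qed.

Lemma loop_homotopic_sym a b : loop_homotopic a b -> loop_homotopic b a.
Proof.
move=> [H [cH Ha Hb H0]]; exists (fun x => H (x.1, clamp (1 - coord x.2))); split=> /=.
- apply: continuous_homotopy => //; apply: continuous_clamp.
  by apply: continuous_sub1; exact: continuous_coord_snd.
- by move=> s; rewrite coord_zero subr0 -Hb.
- by move=> s; rewrite coord_one subrr -Ha.
- by move=> t; exact: H0.
Qed.

Lemma loop_homotopic_trans b a c :
  loop_homotopic a b -> loop_homotopic b c -> loop_homotopic a c.
Proof.
move=> [H [cH Ha Hb H0]] [K [cK Kb Kc K0]].
exists (fun x => if coord x.2 <= 2^-1 then H (x.1, clamp (2 * coord x.2))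
  else K (x.1, clamp (2 * coord x.2 - 1))); split=> /=.
- apply: continuous_if_le.
  + exact: continuous_coord_snd.
  + by apply: continuous_homotopy => //; apply: continuous_clamp; exact: continuous_mull.
  + by apply: continuous_homotopy => //; apply: continuous_clamp; exact: continuous_affine.
  + by move=> x ->; rewrite mulfV // subrr [LHS]Hb [RHS]Kb.
- by move=> s; rewrite coord_zero invr_ge0 ler0n mulr0 -Ha.
- move=> s; rewrite coord_one ifF; first by rewrite mulr1 (_ : 2 - 1 = 1) ?Kc //; lra.
  by apply/negbTE; rewrite -ltNge; lra.
- by move=> t; case: ifP.
Qed.

Lemma loop_homotopic_concat a a' b b' :
  loop_homotopic a a' -> loop_homotopic b b' ->
  loop_homotopic (loop_concat a b) (loop_concat a' b').
Proof.
move=> [H [cH Ha Ha' H0]] [K [cK Kb Kb' K0]].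
exists (fun x => if coord x.1 <= 2^-1 then H (clamp (2 * coord x.1), x.2)
  else K (clamp (2 * coord x.1 - 1), x.2)); split=> /=.
- apply: continuous_if_le.
  + exact: continuous_coord_fst.
  + by apply: continuous_homotopy => //; apply: continuous_clamp; exact: continuous_mull.
  + by apply: continuous_homotopy => //; apply: continuous_clamp; exact: continuous_affine.
  + move=> x ->; rewrite mulfV // subrr.
    by rewrite [LHS](H0 x.2).2 [RHS](K0 x.2).1.
- by move=> s; rewrite Ha Kb.
- by move=> s; rewrite Ha' Kb'.
- move=> t; rewrite coord_zero coord_one; split.
    by rewrite invr_ge0 ler0n mulr0; exact: (H0 t).1.
  rewrite ifF; first by rewrite mulr1 (_ : 2 - 1 = 1); [exact: (K0 t).2|lra].
  by apply/negbTE; rewrite -ltNge; lra.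
Qed.

Lemma loop_homotopic_reparam (a b c : loop) (phi psi : R -> R) :
  continuous phi -> continuous psi -> phi 0 = psi 0 -> phi 1 = psi 1 ->
  (forall s, a s = c (clamp (phi (coord s)))) ->
  (forall s, b s = c (clamp (psi (coord s)))) ->
  loop_homotopic a b.
Proof.
move=> cphi cpsi e0 e1 ha hb.
exists (fun x => c (clamp ((1 - coord x.2) * phi (coord x.1) + coord x.2 * psi (coord x.1)))).
split=> /=.
- apply: continuous_loop; apply: continuous_addM.
  + by apply: continuous_sub1; exact: continuous_coord_snd.
  + exact: (continuous_compf continuous_coord_fst cphi).
  + exact: continuous_coord_snd.
  + exact: (continuous_compf continuous_coord_fst cpsi).
- by move=> s; rewrite coord_zero subr0 mul1r mul0r addr0 ha.
- by move=> s; rewrite coord_one subrr mul1r mul0r add0r hb.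
- move=> t; split.
    rewrite coord_zero -e0 -mulrDl subrK mul1r -[in phi 0]coord_zero -ha.
    exact: (loop_zero a).
  rewrite coord_one -e1 -mulrDl subrK mul1r -[in phi 1]coord_one -ha.
  exact: (loop_one a).
Qed.

Let continuous_affine1 (p q : R) : continuous (fun x : R => p * x + q).
Proof. by apply: (@continuous_affine R id) => x; exact: cvg_id. Qed.

Let continuous_maxr (f g : R -> R) : continuous f -> continuous g ->
  continuous (fun x => Num.max (f x) (g x)).
Proof. by move=> cf cg x; apply: continuous_max; [exact: cf|exact: cg]. Qed.

Let continuous_subf (f g : R -> R) : continuous f -> continuous g ->
  continuous (fun x => f x - g x).
Proof. by move=> cf cg x; apply: cvgB; [exact: cf|exact: cg]. Qed.

Lemma loop_concatE (a b : loop) (s : I01) : loop_concat a b s =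
  if coord s <= 2^-1 then a (clamp (2 * coord s)) else b (clamp (2 * coord s - 1)).
Proof. by []. Qed.

Lemma loop_revE (a : loop) (s : I01) : loop_rev a s = a (clamp (1 - coord s)).
Proof. by []. Qed.

Lemma loop_homotopic_assoc a b c :
  loop_homotopic (loop_concat a (loop_concat b c))
    (loop_concat (loop_concat a b) c).
Proof.
apply: (@loop_homotopic_reparam _ _ (loop_concat (loop_concat a b) c)
  (fun x : R => Num.max (2^-1 * x + 0) (Num.max (1 * x + (- 4^-1)) (2 * x + (- 1))))
  (fun x : R => 1 * x + 0)).
- by apply: continuous_maxr; [|apply: continuous_maxr]; exact: continuous_affine1.
- exact: continuous_affine1.
- by rewrite !mulr0 !add0r max_l // ge_max; apply/andP; split; lra.
- by rewrite !mulr1 max_r; [rewrite max_r; lra|rewrite le_max; apply/orP; right; lra].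
- move=> s; have /andP[s0 s1] := unit_interval_bounds s.
  rewrite !addr0 mul1r; case: (leP (coord s) 2^-1) => s2.
    rewrite max_l; last by rewrite ge_max; apply/andP; split; lra.
    rewrite !loop_concatE s2 clamp_itv; last by apply/andP; split; lra.
    rewrite ifT; last by lra.
    rewrite clamp_itv; last by apply/andP; split; lra.
    rewrite ifT; last by lra.
    by congr (a (clamp _)); lra.
  rewrite max_r; last by rewrite le_max; apply/orP; left; lra.
  case: (leP (coord s) (3 / 4)) => s3.
    rewrite max_l; last by lra.
    rewrite !loop_concatE ifF; last by apply/negbTE; rewrite -ltNge.
    rewrite clamp_itv; last by apply/andP; split; lra.
    rewrite ifT; last by lra.
    rewrite clamp_itv; last by apply/andP; split; lra.
    rewrite ifT; last by lra.
    rewrite clamp_itv; last by apply/andP; split; lra.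
    rewrite ifF; last by apply/negbTE; rewrite -ltNge; lra.
    by congr (b (clamp _)); lra.
  rewrite max_r; last by lra.
  rewrite !loop_concatE ifF; last by apply/negbTE; rewrite -ltNge.
  rewrite clamp_itv; last by apply/andP; split; lra.
  have s4 : (2 * coord s + -1 <= 2^-1) = false by apply/negbTE; rewrite -ltNge; lra.
  by rewrite !s4.
- by move=> s; rewrite mul1r addr0 clampK.
Qed.

Lemma loop_homotopic_cstl a : loop_homotopic (loop_concat loop_cst a) a.
Proof.
apply: (@loop_homotopic_reparam _ _ a
  (fun x : R => Num.max (0 * x + 0) (2 * x + (- 1))) (fun x => 1 * x + 0)).
- by apply: continuous_maxr; exact: continuous_affine1.
- exact: continuous_affine1.
- by rewrite !mulr0 !add0r max_l //; lra.
- by rewrite !mulr1 max_r; lra.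
- move=> s; rewrite loop_concatE mul0r addr0; case: (leP (coord s) 2^-1) => s2.
    by rewrite max_l; [rewrite (loop_zero a)|lra].
  by rewrite max_r //; lra.
- by move=> s; rewrite mul1r addr0 clampK.
Qed.

Lemma loop_homotopic_cstr a : loop_homotopic (loop_concat a loop_cst) a.
Proof.
apply: (@loop_homotopic_reparam _ _ a (fun x : R => 2 * x + 0 - Num.max (0 * x + 0) (2 * x + (- 1)))
  (fun x : R => 1 * x + 0)).
- apply: continuous_subf; first exact: continuous_affine1.
  by apply: continuous_maxr; exact: continuous_affine1.
- exact: continuous_affine1.
- by rewrite !mulr0 !add0r max_l //; lra.
- by rewrite !mulr1 max_r; lra.
- move=> s; rewrite loop_concatE mul0r addr0; case: (leP (coord s) 2^-1) => s2.
    by rewrite max_l; [congr (a (clamp _))|]; lra.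
  rewrite max_r; last by lra.
  by rewrite -[LHS]/x0 -[LHS](loop_one a); congr (a (clamp _)); lra.
- by move=> s; rewrite mul1r addr0 clampK.
Qed.

Lemma loop_homotopic_revl a : loop_homotopic (loop_concat (loop_rev a) a) loop_cst.
Proof.
apply: (@loop_homotopic_reparam _ _ a
  (fun x : R => Num.max ((- 2) * x + 1) (2 * x + (- 1))) (fun x => 0 * x + 1)).
- by apply: continuous_maxr; exact: continuous_affine1.
- exact: continuous_affine1.
- by rewrite !mulr0 !add0r max_l //; lra.
- by rewrite !mulr1 max_r; lra.
- move=> s; have /andP[s0 s1] := unit_interval_bounds s.
  rewrite loop_concatE; case: (leP (coord s) 2^-1) => s2.
    rewrite max_l; last by lra.
    rewrite loop_revE clamp_itv; last by apply/andP; split; lra.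
    by congr (a (clamp _)); lra.
  by rewrite max_r //; lra.
- by move=> s; rewrite mul0r add0r (loop_one a).
Qed.

Lemma loop_homotopic_revr a : loop_homotopic (loop_concat a (loop_rev a)) loop_cst.
Proof.
apply: (@loop_homotopic_reparam _ _ a
  (fun x : R => 0 * x + 1 - Num.max ((- 2) * x + 1) (2 * x + (- 1))) (fun x => 0 * x + 0)).
- apply: continuous_subf; first exact: continuous_affine1.
  by apply: continuous_maxr; exact: continuous_affine1.
- exact: continuous_affine1.
- by rewrite !mulr0 !add0r max_l; lra.
- by rewrite !mulr1 max_r; lra.
- move=> s; have /andP[s0 s1] := unit_interval_bounds s.
  rewrite loop_concatE; case: (leP (coord s) 2^-1) => s2.
    by rewrite max_l; [congr (a (clamp _))|]; lra.
  rewrite max_r; last by lra.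
  rewrite loop_revE clamp_itv; last by apply/andP; split; lra.
  by congr (a (clamp _)); lra.
- by move=> s; rewrite mul0r add0r (loop_zero a).
Qed.

Lemma loop_homotopic_rev a b :
  loop_homotopic a b -> loop_homotopic (loop_rev a) (loop_rev b).
Proof.
move=> [H [cH Ha Hb H0]]; exists (fun x => H (clamp (1 - coord x.1), x.2)); split=> /=.
- apply: continuous_homotopy => //; apply: continuous_clamp.
  by apply: continuous_sub1; exact: continuous_coord_fst.
- by move=> s; rewrite Ha.
- by move=> s; rewrite Hb.
- move=> t; rewrite coord_zero coord_one subr0 subrr.
  by split; [exact: (H0 t).2|exact: (H0 t).1].
Qed.

Definition loop_homotopicb (a b : loop) : bool := `[< loop_homotopic a b >].

Let loop_homotopicb_refl : reflexive loop_homotopicb.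
Proof. by move=> a; apply/asboolP; exact: loop_homotopic_refl. Qed.
Let loop_homotopicb_sym : symmetric loop_homotopicb.
Proof.
by move=> a b; apply/idP/idP => /asboolP h; apply/asboolP; exact: loop_homotopic_sym.
Qed.
Let loop_homotopicb_trans : transitive loop_homotopicb.
Proof.
move=> b a c /asboolP ab /asboolP bc; apply/asboolP.
exact: loop_homotopic_trans bc.
Qed.

Canonical loop_homotopic_equiv := EquivRel loop_homotopicb
  loop_homotopicb_refl loop_homotopicb_sym loop_homotopicb_trans.

Definition pi1 : Type := {eq_quot loop_homotopicb}.
HB.instance Definition _ := Choice.on pi1.
HB.instance Definition _ := Quotient.on pi1.

Definition loop_class (a : loop) : pi1 := \pi_pi1 a.

Lemma loop_classP (a b : loop) :
  loop_class a = loop_class b <-> loop_homotopic a b.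
Proof. by split => [/eqquotP/asboolP|h] //; apply/eqquotP/asboolP. Qed.

Let reprK1 (x : pi1) : loop_class (repr x) = x.
Proof. exact: reprK. Qed.

Let repr_class (a : loop) : loop_homotopic (repr (loop_class a)) a.
Proof. by apply/loop_classP; rewrite reprK1. Qed.

Let pi1_one : pi1 := loop_class loop_cst.
Let pi1_mul (x y : pi1) : pi1 := loop_class (loop_concat (repr x) (repr y)).
Let pi1_inv (x : pi1) : pi1 := loop_class (loop_rev (repr x)).

Let pi1_mulE a b :
  pi1_mul (loop_class a) (loop_class b) = loop_class (loop_concat a b).
Proof. by apply/loop_classP; apply: loop_homotopic_concat; exact: repr_class. Qed.

Let pi1_invE a : pi1_inv (loop_class a) = loop_class (loop_rev a).
Proof. by apply/loop_classP; apply: loop_homotopic_rev; exact: repr_class. Qed.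

Let pi1_mulA : associative pi1_mul.
Proof.
move=> x y z; rewrite -(reprK1 x) -(reprK1 y) -(reprK1 z) !pi1_mulE.
by apply/loop_classP; exact: loop_homotopic_assoc.
Qed.
Let pi1_mul1 : left_id pi1_one pi1_mul.
Proof.
move=> x; rewrite -(reprK1 x) pi1_mulE.
by apply/loop_classP; exact: loop_homotopic_cstl.
Qed.
Let pi1_mulr1 : right_id pi1_one pi1_mul.
Proof.
move=> x; rewrite -(reprK1 x) pi1_mulE.
by apply/loop_classP; exact: loop_homotopic_cstr.
Qed.
Let pi1_mulV : left_inverse pi1_one pi1_inv pi1_mul.
Proof.
move=> x; rewrite -(reprK1 x) pi1_invE pi1_mulE.
by apply/loop_classP; exact: loop_homotopic_revl.
Qed.
Let pi1_mulrV : right_inverse pi1_one pi1_inv pi1_mul.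
Proof.
move=> x; rewrite -(reprK1 x) pi1_invE pi1_mulE.
by apply/loop_classP; exact: loop_homotopic_revr.
Qed.
HB.instance Definition _ := isGroup.Build pi1
  pi1_mulA pi1_mul1 pi1_mulr1 pi1_mulV pi1_mulrV.

Lemma loop_classM (a b : loop) :
  loop_class (loop_concat a b) = (loop_class a * loop_class b)%g.
Proof. by rewrite -pi1_mulE. Qed.

End FundamentalGroup.

Arguments pi1 R {X} x0.
Section WhiteheadLink.
Context (R : realType).

Definition vec3 (x y z : R) : 'rV[R]_3 := \row_(j < 3) nth 0 [:: x; y; z] j.

(* The projection to the (x, y)-plane is the standard diagram of the Whitehead
   link: a figure-eight curve crossing itself at the origin (t = 0 above t = pi)
   and a circle centred at that crossing, which meets the figure eight at
   t = pi/4, 3pi/4, 5pi/4, 7pi/4, where the figure eight runs respectively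
   below, above, above, below the circle.  Hence the five crossings alternate
   along both components. *)
Definition whitehead_link : set 'rV[R]_3 :=
  range (fun t : R => vec3 (2 * sin t) (sin (2 * t)) (cos (3 * t))) `|`
  [set v | v 0 0 ^+ 2 + v 0 1 ^+ 2 = 3 /\ v 0 2 = 0].

Definition sphere3 : topologicalType := one_point_compactification 'rV[R]_3.

Definition whitehead_complement : topologicalType :=
  set_type (~` (Some @` whitehead_link) : set sphere3).

End WhiteheadLink.

Arguments whitehead_link : clear implicits.

Section Unitary.
Context (C : numClosedFieldType).

(* signature (2, 1), antidiagonal: z_1 w_3^* + z_2 w_2^* + z_3 w_1^* *)
Definition herm (z w : 'cV[C]_3) : C :=
  z 0 0 * (w 2 0)^* + z 1 0 * (w 1 0)^* + z 2 0 * (w 0 0)^*.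

Definition unitary21 : set 'M[C]_3 :=
  [set A | forall z w : 'cV[C]_3, herm (A *m z) (A *m w) = herm z w].

Lemma herm_nondegenerate (z : 'cV[C]_3) : (forall w, herm z w = 0) -> z = 0.
Proof.
move=> h; apply/colP => -[[|[|[|//]]] lti]; rewrite mxE.
- have := h (delta_mx 2 0); rewrite /herm !mxE /= !conjC0 conjC1 !mulr0 mulr1.
  by rewrite !addr0 => <-; congr (z _ _); apply: val_inj.
- have := h (delta_mx 1 0); rewrite /herm !mxE /= !conjC0 conjC1 !mulr0 mulr1.
  by rewrite !addr0 add0r => <-; congr (z _ _); apply: val_inj.
- have := h (delta_mx 0 0); rewrite /herm !mxE /= !conjC0 conjC1 !mulr0 mulr1.
  by rewrite !add0r => <-; congr (z _ _); apply: val_inj.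
Qed.

Lemma unitary21_unitmx (A : 'M[C]_3) : unitary21 A -> A \in unitmx.
Proof.
move=> hA; rewrite -unitmx_tr -row_free_unit; apply: inj_row_free => v vA0.
suff -> : v = (v^T)^T by rewrite (_ : v^T = 0) ?trmx0 //; apply: herm_nondegenerate
  => w; rewrite -hA -[A in A *m v^T]trmxK -trmx_mul vA0 trmx0 /herm !mxE !mul0r
  !addr0.
by rewrite trmxK.
Qed.

Lemma unitary21_1 : unitary21 1%:M.
Proof. by move=> z w; rewrite !mul1mx. Qed.

Lemma unitary21_mul (A B : 'M[C]_3) : unitary21 A -> unitary21 B -> unitary21 (A *m B).
Proof. by move=> hA hB z w; rewrite -!mulmxA hA hB. Qed.

Lemma unitary21_inv (A : 'M[C]_3) : unitary21 A -> unitary21 (invmx A).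
Proof.
move=> hA z w; have uA := unitary21_unitmx hA.
by rewrite -hA !mulmxA !mulmxV // !mul1mx.
Qed.

Definition U21 : Type := unitary21.
HB.instance Definition _ := [isSub of U21 for val : {A | A \in unitary21} -> 'M[C]_3].
HB.instance Definition _ := [Choice of U21 by <:].

Definition u21 (A : 'M[C]_3) (hA : unitary21 A) : U21 := Sub A (mem_set hA).

Let u21_one : U21 := u21 unitary21_1.
Let u21_mul (A B : U21) : U21 :=
  u21 (unitary21_mul (set_valP A) (set_valP B)).
Let u21_inv (A : U21) : U21 := u21 (unitary21_inv (set_valP A)).

Let u21_mulA : associative u21_mul.
Proof. by move=> a b c; apply: val_inj; rewrite /= mulmxA. Qed.
Let u21_mul1 : left_id u21_one u21_mul.
Proof. by move=> a; apply: val_inj; rewrite /= mul1mx. Qed.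
Let u21_mulr1 : right_id u21_one u21_mul.
Proof. by move=> a; apply: val_inj; rewrite /= mulmx1. Qed.
Let u21_mulV : left_inverse u21_one u21_inv u21_mul.
Proof.
by move=> a; apply: val_inj; rewrite /= mulVmx // unitary21_unitmx //; exact: set_valP.
Qed.
Let u21_mulrV : right_inverse u21_one u21_inv u21_mul.
Proof.
by move=> a; apply: val_inj; rewrite /= mulmxV // unitary21_unitmx //; exact: set_valP.
Qed.
HB.instance Definition _ := isGroup.Build U21
  u21_mulA u21_mul1 u21_mulr1 u21_mulV u21_mulrV.

Lemma val_u21M (A B : U21) : val (A * B)%g = val A *m val B.
Proof. by []. Qed.

Definition proportional (A B : U21) : bool :=
  `[< exists c : C, val B = c *: val A >].

Lemma u21_val_neq0 (A : U21) : val A != 0.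
Proof.
have uA : val A \in unitmx by apply: unitary21_unitmx; exact: set_valP.
by apply/eqP => A0; move: uA; rewrite A0 unitmxE det0 unitr0.
Qed.

Lemma proportional_refl : reflexive proportional.
Proof. by move=> A; apply/asboolP; exists 1; rewrite scale1r. Qed.

Lemma proportional_sym : symmetric proportional.
Proof.
suff imp A B : proportional A B -> proportional B A.
  by move=> A B; apply/idP/idP; exact: imp.
move=> /asboolP[c Bc]; apply/asboolP; exists c^-1.
have c0 : c != 0.
  by apply/eqP => c0; have := u21_val_neq0 B; rewrite Bc c0 scale0r eqxx.
by rewrite Bc scalerA mulVf // scale1r.
Qed.

Lemma proportional_trans : transitive proportional.
Proof.
move=> B A D /asboolP[c Bc] /asboolP[d Dd]; apply/asboolP; exists (d * c).
by rewrite Dd Bc scalerA.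
Qed.

Canonical proportional_equiv :=
  EquivRel proportional proportional_refl proportional_sym proportional_trans.

Lemma proportionalM (A A' B B' : U21) :
  proportional A A' -> proportional B B' -> proportional (A * B)%g (A' * B')%g.
Proof.
move=> /asboolP[c Ac] /asboolP[d Bd]; apply/asboolP; exists (c * d).
by rewrite !val_u21M Ac Bd -scalemxAl -scalemxAr scalerA.
Qed.

Lemma proportionalV (A A' : U21) :
  proportional A A' -> proportional (A^-1)%g (A'^-1)%g.
Proof.
move=> AA'.
have := proportionalM (proportionalM (proportional_refl A^-1%g) AA')
  (proportional_refl A'^-1%g).
by rewrite mulVg mul1g -mulgA mulgV mulg1 proportional_sym.
Qed.

Definition gaussian_integer (x : C) : Prop :=
  exists a b : int, x = a%:~R + b%:~R * 'i.

Definition mx3 (rows : seq (seq C)) : 'M[C]_3 :=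
  \matrix_(i < 3, j < 3) nth 0 (nth [::] rows i) j.

Definition G1 : 'M[C]_3 := mx3
  [:: [:: 1;        0;      - 'i];
      [:: - 1 - 'i; 1;      - 1 + 'i];
      [:: - 1 - 'i; 1 - 'i; 'i]].

Definition G2 : 'M[C]_3 := mx3
  [:: [:: 1;        1 - 'i; - 1 + 'i];
      [:: - 1 - 'i; - 1;    1 - 'i];
      [:: - 1 + 'i; 1 + 'i; - 1 - 2 * 'i]].

Definition G3 : 'M[C]_3 := mx3
  [:: [:: 'i;       1 + 'i;       - 'i];
      [:: 1 - 'i;   - 1 - 2 * 'i; 2 * 'i];
      [:: - 1 - 'i; - 3 + 'i;     3 + 2 * 'i]].

Definition G4 : 'M[C]_3 := mx3
  [:: [:: - 'i;     0;        0];
      [:: - 1 + 'i; - 1;      0];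
      [:: - 1 + 'i; - 1 + 'i; - 'i]].

Lemma mulmx3E (A : 'M[C]_3) (z : 'cV[C]_3) (i : 'I_3) :
  (A *m z) i 0 = A i 0 * z 0 0 + A i 1 * z 1 0 + A i 2 * z 2 0.
Proof.
rewrite mxE !big_ord_recl big_ord0 addr0 addrA.
by congr (A i _ * z _ 0 + A i _ * z _ 0 + A i _ * z _ 0); apply: val_inj.
Qed.

Ltac unitary_mx3 :=
  move=> z w; rewrite /herm !mulmx3E !mxE /=;
  rewrite !(rmorphD, rmorphB, rmorphM, rmorphN, rmorph1, rmorph0, rmorph_nat)
          /= !conjCi;
  ring: (sqrCi C).

Lemma G1_unitary : unitary21 G1. Proof. unitary_mx3. Qed.
Lemma G2_unitary : unitary21 G2. Proof. unitary_mx3. Qed.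
Lemma G3_unitary : unitary21 G3. Proof. unitary_mx3. Qed.
Lemma G4_unitary : unitary21 G4. Proof. unitary_mx3. Qed.

End Unitary.

Section ProjectiveUnitary.
Context (R : realType).
Local Notation C := (Cplx R).
Local Notation U := (U21 C).

HB.instance Definition _ := Topological.copy U (@unitary21 C).

Definition PU21 : Type := quotient_topology {eq_quot (@proportional C)}.
HB.instance Definition _ := Topological.on PU21.
HB.instance Definition _ := Quotient.on PU21.

Definition pu (A : U) : PU21 := \pi_PU21 A.

Let pu_one : PU21 := pu 1%g.
Let pu_mul (g h : PU21) : PU21 := pu (repr g * repr h)%g.
Let pu_inv (g : PU21) : PU21 := pu ((repr g)^-1)%g.

Lemma pu_eqP (A B : U) : reflect (pu A = pu B) (proportional A B).
Proof. exact: eqquotP. Qed.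

Lemma puK (g : PU21) : pu (repr g) = g.
Proof. exact: reprK. Qed.

Lemma pu_repr (A : U) : proportional (repr (pu A)) A.
Proof. by apply/pu_eqP; rewrite puK. Qed.

Let pu_mul_pi (A B : U) : pu_mul (pu A) (pu B) = pu (A * B)%g.
Proof. by apply/pu_eqP; apply: proportionalM; exact: pu_repr. Qed.

Let pu_inv_pi (A : U) : pu_inv (pu A) = pu (A^-1)%g.
Proof. by apply/pu_eqP; apply: proportionalV; exact: pu_repr. Qed.

Let pu_mulA : associative pu_mul.
Proof.
move=> g h k; rewrite -(puK g) -(puK h) -(puK k).
by rewrite !pu_mul_pi mulgA.
Qed.
Let pu_mul1 : left_id pu_one pu_mul.
Proof. by move=> g; rewrite -(puK g) pu_mul_pi mul1g. Qed.
Let pu_mulr1 : right_id pu_one pu_mul.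
Proof. by move=> g; rewrite -(puK g) pu_mul_pi mulg1. Qed.
Let pu_mulV : left_inverse pu_one pu_inv pu_mul.
Proof. by move=> g; rewrite -(puK g) pu_inv_pi pu_mul_pi mulVg. Qed.
Let pu_mulrV : right_inverse pu_one pu_inv pu_mul.
Proof. by move=> g; rewrite -(puK g) pu_inv_pi pu_mul_pi mulgV. Qed.
HB.instance Definition _ := isGroup.Build PU21
  pu_mulA pu_mul1 pu_mulr1 pu_mulV pu_mulrV.

Definition pu_class (A : 'M[C]_3) (hA : unitary21 A) : PU21 := pu (u21 hA).

Lemma puM (A B : U) : pu (A * B)%g = (pu A * pu B)%g.
Proof. by rewrite -pu_mul_pi. Qed.

Lemma puV (A : U) : pu (A^-1)%g = ((pu A)^-1)%g.
Proof. by rewrite -pu_inv_pi. Qed.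

Lemma pu1 : pu 1%g = 1%g.
Proof. by []. Qed.

Definition PU21_Zi : set PU21 :=
  [set g | exists A : U, g = pu A /\
     forall i j, gaussian_integer (val A i j)].

Definition discrete_subgroup (H : set PU21) : Prop :=
  subgroup H /\ H `<=` isolated H.

Definition discrete_representation (Gamma : groupType)
    (rho : {multiplicative Gamma -> PU21}) : Prop :=
  discrete_subgroup (range rho).

End ProjectiveUnitary.

Arguments PU21_Zi : clear implicits.
Arguments pu_class {R} A hA.

(* Main.v *)
(* The inverse of a unitary matrix is, up to reindexing, its conjugate transpose,
   so the classes of Gaussian unitary matrices form a subgroup, which contains
   the four generators.  Two unitary matrices with the same class differ by a
   scalar of modulus 1, so the products [A i j * (A k l)^*] are continuous
   functions of the class of [A].  On PU(2,1,Z[i]) they take Gaussian integer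
   values, which are at distance at least 1 from each other; for fixed [k], [l]
   with [A k l != 0] they determine the class of [A], which is thus isolated. *)
Require Import Defs.
From mathcomp Require Import all_boot all_order all_algebra.
From mathcomp Require Import all_classical all_reals all_analysis.
From mathcomp Require Import complex ring.
Import Order.TTheory GRing.Theory Num.Theory.
Import numFieldNormedType.Exports.
Local Open Scope classical_set_scope.
Local Open Scope ring_scope.
Set Implicit Arguments.
Unset Strict Implicit.

(** * Gaussian integers, Gaussian matrices and the adjoint *)

Section GaussianIntegers.
Context (C : numClosedFieldType).
Implicit Types x y : C.

Lemma gaussian_integerD x y :
  gaussian_integer x -> gaussian_integer y -> gaussian_integer (x + y).
Proof.
move=> [a [b ->]] [c [d ->]]; exists (a + c), (b + d).
by rewrite !rmorphD /=; ring.
Qed.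

Lemma gaussian_integerN x : gaussian_integer x -> gaussian_integer (- x).
Proof. by move=> [a [b ->]]; exists (- a), (- b); rewrite !rmorphN /=; ring. Qed.

Lemma gaussian_integerM x y :
  gaussian_integer x -> gaussian_integer y -> gaussian_integer (x * y).
Proof.
move=> [a [b ->]] [c [d ->]]; exists (a * c - b * d), (a * d + b * c).
rewrite !(rmorphD, rmorphM, rmorphN) /=; ring: (sqrCi C).
Qed.

Lemma gaussian_integer_int (m : int) : gaussian_integer (m%:~R : C).
Proof. by exists m, 0; rewrite mul0r addr0. Qed.

Lemma gaussian_integer_nat (n : nat) : gaussian_integer (n%:R : C).
Proof. exact: (gaussian_integer_int n). Qed.

Lemma gaussian_integer_i : gaussian_integer ('i : C).
Proof. by exists 0, 1; rewrite mul1r add0r. Qed.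

Lemma gaussian_integer_conj x : gaussian_integer x -> gaussian_integer x^*.
Proof.
move=> [a [b ->]]; exists a, (- b).
by rewrite rmorphD rmorphM /= conjCi !rmorph_int /= rmorphN mulNr mulrN.
Qed.

(** The squared modulus is the integer [a ^+ 2 + b ^+ 2], and a nonnegative integer below 1 is 0. *)
Lemma gaussian_integer_norm_lt1 x : gaussian_integer x -> `|x| < 1 -> x = 0.
Proof.
move=> [a [b ->]] x1.
have nE : `|a%:~R + b%:~R * 'i| ^+ 2 = (a ^+ 2 + b ^+ 2)%:~R :> C.
  rewrite normCK !(rmorphD, rmorphM, rmorphXn) /= conjCi !rmorph_int /=.
  by ring: (sqrCi C).
have : `|a%:~R + b%:~R * 'i| ^+ 2 < 1 :> C by rewrite expr_lt1.
rewrite nE -[1](rmorph1 intr) ltr_int => ab1.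
have /eqP : a ^+ 2 + b ^+ 2 = 0 :> int.
  by apply/eqP; rewrite eq_le addr_ge0 ?sqr_ge0 // andbT -ltzD1 add0r.
rewrite paddr_eq0 ?sqr_ge0 // !sqrf_eq0 => /andP[/eqP -> /eqP ->].
by rewrite mul0r addr0.
Qed.

Definition gaussian_mx m n (A : 'M[C]_(m, n)) : Prop :=
  forall i j, gaussian_integer (A i j).

Lemma gaussian_mxM m n p (A : 'M[C]_(m, n)) (B : 'M[C]_(n, p)) :
  gaussian_mx A -> gaussian_mx B -> gaussian_mx (A *m B).
Proof.
move=> gA gB i j; rewrite mxE; apply: big_ind => [||k _].
- exact: gaussian_integer_nat 0.
- exact: gaussian_integerD.
- exact: gaussian_integerM.
Qed.

Lemma gaussian_mx3 (rows : seq (seq C)) :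
  (forall r x, r \in rows -> x \in r -> gaussian_integer x) ->
  gaussian_mx (mx3 rows).
Proof.
move=> h i j; rewrite mxE.
(* Positions missing from the lists read the default value 0, which is Gaussian. *)
case: (ltnP i (size rows)) => [ir|ir]; last first.
  by rewrite [nth [::] _ _]nth_default // nth_nil; exact: gaussian_integer_nat 0.
case: (ltnP j (size (nth [::] rows i))) => jr; last first.
  by rewrite nth_default //; exact: gaussian_integer_nat 0.
exact: h (mem_nth _ ir) (mem_nth _ jr).
Qed.

(* [herm] is represented by the antidiagonal matrix, so the adjoint is the
   conjugate reflection of [A] in its antidiagonal. *)
Lemma invmx_unitary21 (A : 'M[C]_3) : unitary21 A ->
  invmx A = \matrix_(i, j) (A (rev_ord j) (rev_ord i))^*.
Proof.
move=> uA; set B := \matrix_(i, j) _.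
suff BA : B *m A = 1%:M.
  by rewrite -[LHS]mul1mx -BA -mulmxA mulmxV ?mulmx1 // unitary21_unitmx.
apply/matrixP => i k.
(* For basis vectors [e_k] and [e_(rev i)], the form of their images is the entry [(i, k)] of
   [B *m A], while their own form is 1 if [i = k] and 0 otherwise. *)
have := uA (delta_mx k 0) (delta_mx (rev_ord i) 0).
rewrite -!colE /herm !mxE !big_ord_recl big_ord0 !mxE.
rewrite !andbT !conjC_nat.
have -> : rev_ord ord0 = 2 :> 'I_3 by apply: val_inj.
have -> : rev_ord (lift ord0 ord0) = 1 :> 'I_3 by apply: val_inj.
have -> : rev_ord (lift ord0 (lift ord0 ord0)) = 0 :> 'I_3 by apply: val_inj.
have -> : lift ord0 ord0 = 1 :> 'I_3 by apply: val_inj.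
have -> : lift ord0 (lift ord0 ord0) = 2 :> 'I_3 by apply: val_inj.
rewrite addr0 ![_^* * _]mulrC addrA => ->.
by case: i => -[|[|[|//]]] ?; case: k => -[|[|[|//]]] ?;
  rewrite -!val_eqE /= !(mulr0, mul0r, mulr1, addr0, add0r).
Qed.

End GaussianIntegers.

Ltac gaussian_entry :=
  repeat first [exact: gaussian_integer_i | exact: gaussian_integer_nat
    | exact: (gaussian_integer_nat _ 1) | exact: (gaussian_integer_nat _ 0)
    | apply: gaussian_integerD | apply: gaussian_integerN
    | apply: gaussian_integerM].

Ltac gaussian_mx3 :=
  apply: gaussian_mx3 => r x; rewrite !inE => /or3P[] /eqP ->;
  rewrite !inE => /or3P[] /eqP ->; gaussian_entry.

Lemma G1_gaussian (C : numClosedFieldType) : gaussian_mx (G1 C).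
Proof. gaussian_mx3. Qed.
Lemma G2_gaussian (C : numClosedFieldType) : gaussian_mx (G2 C).
Proof. gaussian_mx3. Qed.
Lemma G3_gaussian (C : numClosedFieldType) : gaussian_mx (G3 C).
Proof. gaussian_mx3. Qed.
Lemma G4_gaussian (C : numClosedFieldType) : gaussian_mx (G4 C).
Proof. gaussian_mx3. Qed.

(** * Subgroups, isolated points and continuity *)

Section Subgroups.
Context (G : groupType).

Lemma generated_subgroup_sub (S H : set G) :
  subgroup H -> S `<=` H -> generated_subgroup S `<=` H.
Proof. by move=> sH SH; apply: bigcap_inf; split. Qed.

Lemma subgroup_range (Gamma : groupType) (rho : {multiplicative Gamma -> G}) :
  subgroup (range rho).
Proof.
(* Cancel [rho 1] in [rho 1 * rho 1 = rho 1]; inverses are treated likewise below. *)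
have rho1 : rho 1%g = 1%g.
  by apply: (@mulgI _ (rho 1%g)); rewrite -gmulfM !mulg1.
split=> [|_ _ [x _ <-] [y _ <-]|_ [x _ <-]].
- by exists 1%g.
- by exists (x * y)%g => //; rewrite gmulfM.
- exists (x^-1)%g => //; apply: (@mulgI _ (rho x)).
  by rewrite -gmulfM !mulgV.
Qed.

End Subgroups.

(** A neighbourhood isolating the point in [B] also isolates it in [A]; this passes discreteness
    down to the image of [rho]. *)
Lemma isolated_sub (T : topologicalType) (A B : set T) :
  A `<=` B -> A `&` isolated B `<=` isolated A.
Proof.
move=> AB x [Ax [_ [V nV VB]]]; split; first exact: mem_set.
exists V => //; apply/seteqP; split=> [y [Vy Ay]|y ->].
  by rewrite -VB; split=> //; exact: AB.
by split=> //; exact: nbhs_singleton nV.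
Qed.

Lemma conjC_continuous (K : numClosedFieldType) : continuous (fun x : K => x^*).
Proof.
move=> x; apply/(@cvgrPdist_lt _ _ _ (nbhs x) _) => e e0; near=> y.
rewrite -rmorphB norm_conjC; near: y.
by apply: (@cvgr_dist_lt _ _ _ _ _ id x) => //; exact: cvg_id.
Unshelve. all: by end_near. Qed.

Lemma mx_mul_conj_continuous (K : numClosedFieldType) m n (i k : 'I_m)
    (j l : 'I_n) :
  continuous (fun M : 'M[K]_(m, n) => M i j * (M k l)^*).
Proof.
move=> M; apply: (@cvgM _ _ (nbhs M) _); first exact: coord_continuous.
apply: (@continuous_comp _ _ _ (fun N : 'M[K]_(m, n) => N k l)).
  exact: coord_continuous.
exact: conjC_continuous.
Qed.

(** * Discreteness of PU(2,1,Z[i]) *)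

Section PU21Zi.
Context (R : realType).
Local Notation C := (Cplx R).

Lemma PU21_Zi_subgroup : subgroup (PU21_Zi R).
Proof.
split=> [|_ _ [A [-> gA]] [B [-> gB]]|_ [A [-> gA]]].
- exists 1%g; split; first by rewrite pu1.
  by move=> i j; rewrite mxE; exact: gaussian_integer_nat.
- by exists (A * B)%g; split; [rewrite puM|exact: gaussian_mxM].
- exists (A^-1)%g; split; first by rewrite puV.
  move=> i j; rewrite [val _]invmx_unitary21; last exact: set_valP.
  by rewrite mxE; exact: gaussian_integer_conj.
Qed.

(* A unimodular rescaling of [A] does not change the products
   [A i j * (A k l)^*], so these are functions on PU(2,1). *)
Lemma proportional_mul_conj (A B : U21 C) i j k l : proportional A B ->
  val B i j * (val B k l)^* = val A i j * (val A k l)^*.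
Proof.
move=> /asboolP[c Bc].
suff c1 : c * c^* = 1.
  by rewrite Bc !mxE rmorphM /= mulrACA c1 mul1r.
have hB : unitary21 (val B) := set_valP B.
have hA : unitary21 (val A) := set_valP A.
(* The form is 1 on this pair, so preservation by both [A] and [c *: A] leaves [c * c^* = 1]. *)
have := hB (delta_mx 0 0) (delta_mx 2 0).
rewrite Bc -!scalemxAl.
have -> z w : herm (c *: z) (c *: w) = c * c^* * herm z w.
  by rewrite /herm !mxE !rmorphM /=; ring.
rewrite hA /herm !mxE /= !conjC0 conjC1.
by rewrite !(mulr0, mul0r, mulr1, addr0).
Qed.

Lemma mul_conj_continuous i j k l :
  continuous (fun A : U21 C => val A i j * (val A k l)^* : C).
Proof.
move=> A; apply: (@continuous_comp _ _ _ (val : U21 C -> 'M[C]_3)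
  (fun M => M i j * (M k l)^*)); first exact: initial_continuous.
exact: mx_mul_conj_continuous.
Qed.

Lemma open_mul_conj_lt1 (M : 'M[C]_3) k l :
  open [set A : U21 C |
    forall p : 'I_3 * 'I_3, `|val A p.1 p.2 * (val A k l)^* - M p.1 p.2| < 1].
Proof.
rewrite openE => A hA; apply: (@filter_forall _ _ _ (nbhs A) _) => -[i j].
have := @cvgr_dist_lt _ _ _ (nbhs A) _ _ _ (@mul_conj_continuous i j k l A).
(* The radius is the slack left in the strict bound, as the triangle inequality requires. *)
move=> /(_ _ (1 - `|val A i j * (val A k l)^* - M i j|)).
rewrite subr_gt0 => /(_ (hA (i, j))); apply: filterS => B hB /=.
rewrite -[X in `|X|](subrKA (val A i j * (val A k l)^*)).
apply: le_lt_trans (ler_normD _ _) _.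
by rewrite -ltrBrDr distrC.
Qed.

Lemma PU21_Zi_isolated : PU21_Zi R `<=` isolated (PU21_Zi R).
Proof.
move=> g Zg; split; first exact: mem_set.
have [A [gE gA]] := Zg.
have [k [l Akl]] : exists k l, val A k l != 0.
  have /eqP A0 := u21_val_neq0 A; apply: contrapT => h; apply: A0.
  apply/matrixP => k l; rewrite mxE; apply/eqP; apply: contrapT => /negP Akl.
  by apply: h; exists k, l.
pose M : 'M[C]_3 := (val A k l)^* *: val A.
pose V := [set h : PU21 R | let B : U21 C := repr h in
  forall p : 'I_3 * 'I_3, `|val B p.1 p.2 * (val B k l)^* - M p.1 p.2| < 1].
(* [V] does not depend on the representative chosen by [repr], so its preimage in U(2,1) is the open
   set of [open_mul_conj_lt1]. *)
have VE (B : U21 C) : V (pu B) = (forall p : 'I_3 * 'I_3,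
    `|val B p.1 p.2 * (val B k l)^* - M p.1 p.2| < 1).
  rewrite /V /=; apply/propext; split=> h p; have := h p;
  by rewrite (proportional_mul_conj _ _ _ _ (pu_repr B)).
have Vg : V g by rewrite gE VE => p; rewrite !mxE mulrC subrr normr0 ltr01.
exists V.
  apply: open_nbhs_nbhs; split => //.
  rewrite /open /= /quotient_open.
  rewrite (_ : _ @^-1` V = [set B : U21 C | forall p : 'I_3 * 'I_3,
    `|val B p.1 p.2 * (val B k l)^* - M p.1 p.2| < 1]).
    exact: open_mul_conj_lt1.
  by apply/seteqP; split=> B; rewrite /= -VE.
apply/seteqP; split=> [h [Vh [B [hE gB]]]|_ -> //] /=.
move: Vh; rewrite hE VE => Bint.
(* Both sides are Gaussian integers at distance less than 1. *)
have BE i j : val B i j * (val B k l)^* = val A i j * (val A k l)^*.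
  apply/eqP; rewrite -subr_eq0; apply/eqP; apply: gaussian_integer_norm_lt1.
    apply: gaussian_integerD; last apply: gaussian_integerN;
    by apply: gaussian_integerM => //; exact: gaussian_integer_conj.
  by have := Bint (i, j); rewrite !mxE [X in _ - X]mulrC.
rewrite gE; apply/esym/pu_eqP/asboolP.
(* Solving [BE] for [val B i j] gives this scalar; [BE] at [(k, l)] shows that the denominator is
   nonzero. *)
exists ((val A k l)^* / (val B k l)^*).
have Bkl : (val B k l)^* != 0.
  apply/eqP => B0; have := BE k l; rewrite B0 mulr0 => /esym/eqP.
  by rewrite mulf_eq0 conjC_eq0 orbb (negbTE Akl).
by apply/matrixP => i j; rewrite mxE mulrAC [_^* * _]mulrC -BE mulfK.
Qed.

End PU21Zi.

Theorem theorem6p1 (R : realType) (x0 : whitehead_complement R)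
    (rho : {multiplicative pi1 R x0 -> PU21 R}) :
  range rho = generated_subgroup
    [set pu_class (G1 (Cplx R)) (@G1_unitary _);
         pu_class (G2 (Cplx R)) (@G2_unitary _);
         pu_class (G3 (Cplx R)) (@G3_unitary _);
         pu_class (G4 (Cplx R)) (@G4_unitary _)] ->
  range rho `<=` PU21_Zi R /\ discrete_representation rho.
Proof.
move=> rhoE.
have sub : range rho `<=` PU21_Zi R.
  rewrite rhoE; apply: generated_subgroup_sub; first exact: PU21_Zi_subgroup.
  (* Each generator is represented by its displayed matrix, so only the entries remain to be
     checked. *)
  move=> g [[[|]|]|] ->; eexists; split; try reflexivity.
  - exact: G1_gaussian.
  - exact: G2_gaussian.
  - exact: G3_gaussian.
  - exact: G4_gaussian.
split=> //; split; first exact: subgroup_range.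
by move=> g rg; apply: (isolated_sub sub); split=> //; apply/PU21_Zi_isolated/sub.
Qed.
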